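(* Let $\mathscr{A}=(a_{ijklpq})\in\mathbb{T}_{6,3}$ be a paired symmetric tensor (in particular, possibly an elasticity tensor). Then the following are equivalent: (i) the polynomial $\mathscr{A}x^2y^2z^2$ is positive definite; (ii) the matrix $A(y,z)$ is positive definite for all $y,z\in\mathbb{R}^3\setminus\{0\}$; (iii) the matrix $B(x,z)$ is positive definite for all $x,z\in\mathbb{R}^3\setminus\{0\}$; (iv) the matrix $C(x,y)$ is positive definite for all $x,y\in\mathbb{R}^3\setminus\{0\}$. Furthermore, if $\mathscr{A}$ is an elasticity tensor, then conditions (ii), (iii) and (iv) are the same.
   Context: $\mathbb{T}_{6,3}$ is the set of real tensors $\mathscr{A}=(a_{ijklpq})$ with $i,j,k,l,p,q\in\{1,2,3\}$. $\mathscr{A}$ is paired symmetric if $a_{ijklpq}=a_{jiklpq}=a_{ijlkpq}=a_{ijklqp}$ for all indices; a paired symmetric tensor is an elasticity tensor if moreover $a_{ijklpq}=a_{klijpq}=a_{ijpqkl}$ for all indices. For $x,y,z\in\mathbb{R}^3$, $\mathscr{A}x^2y^2z^2:=\sum_{i,j,k,l,p,q=1}^3a_{ijklpq}x_ix_jy_ky_lz_pz_q$; this polynomial is positive definite if $\mathscr{A}x^2y^2z^2>0$ for all $x,y,z\in\mathbb{R}^3\setminus\{0\}$. For a fourth order tensor $\mathscr{D}=(d_{abcd})$ with indices in $\{1,2,3\}$ and $u,v\in\mathbb{R}^3$, $\mathscr{D}u^2v^2:=\sum d_{abcd}u_au_bv_cv_d$. The fourth order sub-tensors of $\mathscr{A}$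 are $\mathscr{A}_{ij}:=(a_{ijklpq})_{klpq}$ ($i,j$ fixed), $\mathscr{B}_{kl}:=(a_{ijklpq})_{ijpq}$ ($k,l$ fixed), $\mathscr{C}_{pq}:=(a_{ijklpq})_{ijkl}$ ($p,q$ fixed). $A(y,z)$, $B(x,z)$, $C(x,y)\in\mathbb{R}^{3\times3}$ are the matrices whose $(s,t)$ entries are $\mathscr{A}_{st}y^2z^2$, $\mathscr{B}_{st}x^2z^2$, $\mathscr{C}_{st}x^2y^2$ respectively. *)

(* Defs.v *)
From mathcomp Require Import all_boot all_order all_algebra.
From mathcomp Require Import reals.

Set Implicit Arguments.
Unset Strict Implicit.
Unset Printing Implicit Defensive.

Import GRing.Theory Num.Theory.

Local Open Scope ring_scope.

Definition tensor4 (R : realType) := 'I_3 -> 'I_3 -> 'I_3 -> 'I_3 -> R.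

Definition tensor6 (R : realType) :=
  'I_3 -> 'I_3 -> 'I_3 -> 'I_3 -> 'I_3 -> 'I_3 -> R.

Definition paired_symmetric (R : realType) (a : tensor6 R) : Prop :=
  forall i j k l p q,
    [/\ a i j k l p q = a j i k l p q,
        a i j k l p q = a i j l k p q
      & a i j k l p q = a i j k l q p].

Definition elasticity (R : realType) (a : tensor6 R) : Prop :=
  paired_symmetric a /\
  forall i j k l p q,
    a i j k l p q = a k l i j p q /\ a i j k l p q = a i j p q k l.

Definition tform6 (R : realType) (a : tensor6 R) (x y z : 'cV[R]_3) : R :=
  \sum_i \sum_j \sum_k \sum_l \sum_p \sum_q
    a i j k l p q * x i 0 * x j 0 * y k 0 * y l 0 * z p 0 * z q 0.

Definition tform4 (R : realType) (d : tensor4 R) (u v : 'cV[R]_3) : R :=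
  \sum_a \sum_b \sum_c \sum_e d a b c e * u a 0 * u b 0 * v c 0 * v e 0.

Definition tform6_posdef (R : realType) (a : tensor6 R) : Prop :=
  forall x y z : 'cV[R]_3, x != 0 -> y != 0 -> z != 0 -> 0 < tform6 a x y z.

Definition subA (R : realType) (a : tensor6 R) (i j : 'I_3) : tensor4 R :=
  fun k l p q => a i j k l p q.

Definition subB (R : realType) (a : tensor6 R) (k l : 'I_3) : tensor4 R :=
  fun i j p q => a i j k l p q.

Definition subC (R : realType) (a : tensor6 R) (p q : 'I_3) : tensor4 R :=
  fun i j k l => a i j k l p q.

Definition matA (R : realType) (a : tensor6 R) (y z : 'cV[R]_3) : 'M[R]_3 :=
  \matrix_(s, t) tform4 (subA a s t) y z.

Definition matB (R : realType) (a : tensor6 R) (x z : 'cV[R]_3) : 'M[R]_3 :=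
  \matrix_(s, t) tform4 (subB a s t) x z.

Definition matC (R : realType) (a : tensor6 R) (x y : 'cV[R]_3) : 'M[R]_3 :=
  \matrix_(s, t) tform4 (subC a s t) x y.

(* Symmetry is part of positive definiteness of a real matrix. *)
Definition posdefmx (R : realType) (n : nat) (M : 'M[R]_n) : Prop :=
  M^T = M /\ forall x : 'cV[R]_n, x != 0 -> 0 < (x^T *m M *m x) 0 0.

(* Main.v *)
(** Each quadratic form [v^T M v], with [M] one of [A(y,z)], [B(x,z)], [C(x,y)],
    is the sextic form [tform6 a] with its summations regrouped, so each matrix
    condition is condition (i) read in one block of variables.  The cases of
    [B] and [C] reduce to that of [A] by moving the corresponding pair of tensor
    indices to the front. *)
Require Import Defs.
From mathcomp Require Import all_boot all_order all_algebra.
From mathcomp Require Import reals ring.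

Local Open Scope ring_scope.

(** Paired indices travel together: this moves one pair of sums past another as a block. *)
Lemma exchange_big2 (V : nmodType) (I J : finType) (F : I -> I -> J -> J -> V) :
  \sum_i \sum_j \sum_k \sum_l F i j k l = \sum_k \sum_l \sum_i \sum_j F i j k l.
Proof.
under eq_bigr => i _.
  rewrite exchange_big /=; under eq_bigr => k _ do rewrite exchange_big /=.
  over.
rewrite exchange_big /=; apply: eq_bigr => k _.
by rewrite exchange_big.
Qed.

Lemma mulmx_quadE (R : comPzRingType) (n : nat) (M : 'M[R]_n) (x : 'cV[R]_n) :
  (x^T *m M *m x) 0 0 = \sum_s \sum_t M s t * x s 0 * x t 0.
Proof.
rewrite mxE exchange_big /=; apply: eq_bigr => t _.
rewrite mxE big_distrl /=; apply: eq_bigr => s _.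
by rewrite mxE [_ * M s t]GRing.mulrC.
Qed.

(** The order of the remaining pairs is chosen so that [matA (secondpair_first a)] is convertible to
    [matB a]; likewise [matA (thirdpair_first a)] below to [matC a]. *)
Definition secondpair_first {R : realType} (a : tensor6 R) : tensor6 R :=
  fun k l i j p q => a i j k l p q.

Definition thirdpair_first {R : realType} (a : tensor6 R) : tensor6 R :=
  fun p q i j k l => a i j k l p q.

Section TensorForm.
Variables (R : realType) (a : tensor6 R).

Lemma quad_matA (x y z : 'cV[R]_3) :
  (x^T *m matA a y z *m x) 0 0 = tform6 a x y z.
Proof.
rewrite mulmx_quadE; apply: eq_bigr => i _; apply: eq_bigr => j _.
(* The two outer sums already agree; the factors from [x] are pushed through the four inner ones. *)
rewrite mxE /tform4; do 4!(rewrite !big_distrl /=; apply: eq_bigr => ? _).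
by rewrite /subA; ring.
Qed.

Lemma tform6_secondpair_first (x y z : 'cV[R]_3) :
  tform6 (secondpair_first a) y x z = tform6 a x y z.
Proof.
rewrite /tform6 exchange_big2.
do 6!apply: eq_bigr => ? _.
by rewrite /secondpair_first; ring.
Qed.

Lemma tform6_thirdpair_first (x y z : 'cV[R]_3) :
  tform6 (thirdpair_first a) z x y = tform6 a x y z.
Proof.
rewrite /tform6 exchange_big2; do 2!apply: eq_bigr => ? _.
(* The pair contracted with [z] has passed the [x] pair; it now passes the [y] pair. *)
rewrite exchange_big2; do 4!apply: eq_bigr => ? _.
by rewrite /thirdpair_first; ring.
Qed.

Lemma paired_symmetric_secondpair_first :
  paired_symmetric a -> paired_symmetric (secondpair_first a).
Proof. by move=> ha k l i j p q; have [] := ha i j k l p q; split. Qed.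

Lemma paired_symmetric_thirdpair_first :
  paired_symmetric a -> paired_symmetric (thirdpair_first a).
Proof. by move=> ha p q i j k l; have [] := ha i j k l p q; split. Qed.

(** Supplies the symmetry clause of [posdefmx], from the swap inside the first index pair. *)
Lemma trmx_matA (y z : 'cV[R]_3) :
  paired_symmetric a -> (matA a y z)^T = matA a y z.
Proof.
move=> ha; apply/matrixP => s t; rewrite !mxE.
apply: eq_bigr => k _; apply: eq_bigr => l _.
apply: eq_bigr => p _; apply: eq_bigr => q _.
by rewrite /subA; have [-> _ _] := ha t s k l p q.
Qed.

(** Exchanging the first two index pairs identifies [subA a s t] with [subB a s t] entry by entry,
    so the matrices themselves coincide, which is stronger than equivalent conditions. *)
Lemma elasticity_matAB (u v : 'cV[R]_3) :
  elasticity a -> matA a u v = matB a u v.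
Proof.
move=> [_ ha]; apply/matrixP => s t; rewrite !mxE.
apply: eq_bigr => k _; apply: eq_bigr => l _.
apply: eq_bigr => p _; apply: eq_bigr => q _.
by rewrite /subA /subB; have [-> _] := ha s t k l p q.
Qed.

Lemma elasticity_matBC (u v : 'cV[R]_3) :
  elasticity a -> matB a u v = matC a u v.
Proof.
move=> [_ ha]; apply/matrixP => s t; rewrite !mxE.
apply: eq_bigr => i _; apply: eq_bigr => j _.
apply: eq_bigr => p _; apply: eq_bigr => q _.
by rewrite /subB /subC; have [_ ->] := ha i j s t p q.
Qed.

End TensorForm.

Lemma tform6_posdef_matA (R : realType) (a : tensor6 R) :
  paired_symmetric a ->
  tform6_posdef a <->
  forall y z : 'cV[R]_3, y != 0 -> z != 0 -> posdefmx (matA a y z).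
Proof.
move=> ha; split=> [pos y z y0 z0 | pos x y z x0 y0 z0].
  split; first exact: trmx_matA.
  by move=> x x0; rewrite quad_matA; apply: pos.
by rewrite -quad_matA; apply: (pos y z y0 z0).2.
Qed.

Lemma tform6_posdef_matB (R : realType) (a : tensor6 R) :
  paired_symmetric a ->
  tform6_posdef a <->
  forall x z : 'cV[R]_3, x != 0 -> z != 0 -> posdefmx (matB a x z).
Proof.
(* The condition on [matB a] is, by conversion, that on [matA (secondpair_first a)]; what remains is
   to compare two sextic forms. *)
move=> /paired_symmetric_secondpair_first/tform6_posdef_matA <-.
split=> pos x y z x0 y0 z0.
  by rewrite tform6_secondpair_first; apply: pos.
by rewrite -tform6_secondpair_first; apply: pos.
Qed.

Lemma tform6_posdef_matC (R : realType) (a : tensor6 R) :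
  paired_symmetric a ->
  tform6_posdef a <->
  forall x y : 'cV[R]_3, x != 0 -> y != 0 -> posdefmx (matC a x y).
Proof.
move=> /paired_symmetric_thirdpair_first/tform6_posdef_matA <-.
split=> pos x y z x0 y0 z0.
  by rewrite tform6_thirdpair_first; apply: pos.
by rewrite -tform6_thirdpair_first; apply: pos.
Qed.

Theorem proposition4p4 (R : realType) (a : tensor6 R)
    (ha : paired_symmetric a) :
  [<-> tform6_posdef a;
       forall y z : 'cV[R]_3, y != 0 -> z != 0 -> posdefmx (matA a y z);
       forall x z : 'cV[R]_3, x != 0 -> z != 0 -> posdefmx (matB a x z);
       forall x y : 'cV[R]_3, x != 0 -> y != 0 -> posdefmx (matC a x y)]
  /\ (elasticity a ->
      forall u v : 'cV[R]_3,
        matA a u v = matB a u v /\ matB a u v = matC a u v).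
Proof.
have eqA := tform6_posdef_matA _ _ ha.
have eqB := tform6_posdef_matB _ _ ha.
have eqC := tform6_posdef_matC _ _ ha.
split; last first.
  move=> ela u v.
  by split; [exact: elasticity_matAB | exact: elasticity_matBC].
(* The cycle of four implications is closed by passing through [tform6_posdef a] each time. *)
tfae.
- exact: eqA.1.
- by move=> /eqA/eqB.
- by move=> /eqB/eqC.
- exact: eqC.2.
Qed.
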